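(* Let $\Psi:\mathbb{R}^n\to\mathbb{R}$ be differentiable with $\|\nabla\Psi(y)-\nabla\Psi(x)\|\le L_\Psi\|y-x\|$ for all $x,y$ (with $L_\Psi>0$), bounded from below, and let $\Psi^*=\inf_{x\in\mathbb{R}^n}\Psi(x)$. Consider the accelerated gradient (AG) method: given $x_0\in\mathbb{R}^n$, parameters $\{\alpha_k\}$ with $\alpha_1=1$, $\alpha_k\in(0,1)$ for $k\ge2$, $\{\beta_k>0\}$ and $\{\lambda_k>0\}$, set $x^{ag}_0=x_0$ and for $k=1,2,\ldots$ $$x^{md}_k=(1-\alpha_k)x^{ag}_{k-1}+\alpha_kx_{k-1},\quad x_k=x_{k-1}-\lambda_k\nabla\Psi(x^{md}_k),\quad x^{ag}_k=x^{md}_k-\beta_k\nabla\Psi(x^{md}_k).$$ Let $\Gamma_1=1$ and $\Gamma_k=(1-\alpha_k)\Gamma_{k-1}$ for $k\ge2$. (a) Let $N\ge1$. If for all $k=1,\ldots,N$ $$C_k:=1-L_\Psi\lambda_k-\frac{L_\Psi(\lambda_k-\beta_k)^2}{2\alpha_k\Gamma_k\lambda_k}\Big(\sum_{\tau=k}^N\Gamma_\tau\Big)>0,$$ then $$\min_{k=1,\ldots,N}\|\nabla\Psi(x^{md}_k)\|^2\le\frac{\Psi(x_0)-\Psi^*}{\sum_{k=1}^N\lambda_kC_k}.$$ (b) Suppose in addition that $\Psi$ is convex and that an optimal solution $x^*$ of $\min_{x\in\mathbb{R}^n}\Psi(x)$ exists. If $\alpha_k\lambda_k\le\beta_k<1/L_\Psi$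 for all $k$ and $\frac{\alpha_1}{\lambda_1\Gamma_1}\ge\frac{\alpha_2}{\lambda_2\Gamma_2}\ge\cdots$, then for any $N\ge1$, $$\min_{k=1,\ldots,N}\|\nabla\Psi(x^{md}_k)\|^2\le\frac{\|x_0-x^*\|^2}{\lambda_1\sum_{k=1}^N\Gamma_k^{-1}\beta_k(1-L_\Psi\beta_k)},\qquad \Psi(x^{ag}_N)-\Psi(x^* )\le\frac{\Gamma_N\|x_0-x^*\|^2}{2\lambda_1}.$$
   Context: $\|\cdot\|$ is the Euclidean norm on $\mathbb{R}^n$. *)

(* Defs.v *)
From HB Require Import structures.
From mathcomp Require Import all_boot all_order all_algebra.
From mathcomp Require Import all_classical all_reals all_analysis.
Set Implicit Arguments. Unset Strict Implicit. Unset Printing Implicit Defensive.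
Import Order.TTheory GRing.Theory Num.Theory.
Import numFieldNormedType.Exports.
Local Open Scope ring_scope.
Local Open Scope classical_set_scope.

Section Defs.
Variables (R : realType) (n : nat).
Notation V := 'rV[R]_n.

Definition dotv (u v : V) : R := \sum_(i < n) u ord0 i * v ord0 i.
Definition enorm (u : V) : R := Num.sqrt (dotv u u).

Definition grad (Psi : V -> R) (x : V) : V :=
  \row_(i < n) ('D_(delta_mx 0 i) Psi x).

Definition convex_fun (Psi : V -> R) : Prop :=
  forall (x y : V) (t : R), 0 <= t -> t <= 1 ->
    Psi (t *: x + (1 - t) *: y) <= t * Psi x + (1 - t) * Psi y.

Fixpoint ag_state (Psi : V -> R) (x0 : V) (alpha beta lambda : nat -> R)
  (k : nat) : V * V :=
  match k with
  | 0 => (x0, x0)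
  | k'.+1 =>
      let st := ag_state Psi x0 alpha beta lambda k' in
      let md := (1 - alpha k) *: st.2 + alpha k *: st.1 in
      (st.1 - lambda k *: grad Psi md, md - beta k *: grad Psi md)
  end.

Definition ag_x Psi x0 alpha beta lambda k := (ag_state Psi x0 alpha beta lambda k).1.
Definition ag_xag Psi x0 alpha beta lambda k := (ag_state Psi x0 alpha beta lambda k).2.
(* x^md_k, meaningful for k >= 1 *)
Definition ag_xmd Psi x0 (alpha beta lambda : nat -> R) (k : nat) : V :=
  (1 - alpha k) *: ag_xag Psi x0 alpha beta lambda k.-1
  + alpha k *: ag_x Psi x0 alpha beta lambda k.-1.

End Defs.

(* Gamma_1 = 1, Gamma_k = (1 - alpha_k) Gamma_{k-1} for k >= 2
   (Gamma_0 is an unused dummy value). *)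
Fixpoint Gam (R : realType) (alpha : nat -> R) (k : nat) : R :=
  match k with
  | 0 => 1
  | 1 => 1
  | (k'.+1) as k1 => (1 - alpha k1) * Gam alpha k'
  end.

Definition min_1N (R : realType) (N : nat) (f : nat -> R) : R :=
  \big[Num.min/f 1%N]_(1 <= k < N.+1) f k.

Definition Ck (R : realType) (L : R) (alpha beta lambda : nat -> R) (N k : nat) : R :=
  1 - L * lambda k
  - (L * (lambda k - beta k) ^+ 2) / (2 * alpha k * Gam alpha k * lambda k)
    * (\sum_(k <= t < N.+1) Gam alpha t).

(* Main.v *)
(* Write g_k for the gradient at x^md_k; an L-Lipschitz gradient gives the
   descent inequality Psi(x + d) <= Psi(x) + <grad Psi(x), d> + L/2 |d|^2.

   (a) Apply it at x_{k-1} with step - lambda_k g_k. The error comes from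
   evaluating the gradient at x^md_k instead of x_{k-1}, and
   |x^md_k - x_{k-1}| = (1 - alpha_k) |x^ag_{k-1} - x_{k-1}|. By convexity of
   the square, |x^ag_k - x_k|^2 / Gamma_k grows by at most
   (lambda_k - beta_k)^2 / (alpha_k Gamma_k) |g_k|^2 at each step; summing over
   k and exchanging the double sum produces the C_k.

   (b) Apply it at x^md_k with step - beta_k g_k and bound Psi(x^md_k) through
   the gradient inequality at x^ag_{k-1} and xstar. Then
   (Psi(x^ag_k) - Psi(xstar)) / Gamma_k
     + alpha_k / (2 lambda_k Gamma_k) |x_k - xstar|^2
   decreases by at least beta_k (1 - L beta_k) / (2 Gamma_k) |g_k|^2. *)
Require Import Defs.
From HB Require Import structures.
From mathcomp Require Import all_boot all_order all_algebra.
From mathcomp Require Import all_classical all_reals all_analysis.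
From mathcomp Require Import ring lra.
Import Order.TTheory GRing.Theory Num.Theory.
Import numFieldNormedType.Exports.
Local Open Scope ring_scope.
Local Open Scope classical_set_scope.

(** * The Euclidean inner product and two quadratic inequalities *)

Section EuclideanInnerProduct.
Variables (R : realType) (n : nat).
Implicit Types u v w : 'rV[R]_n.

Lemma dotvC u v : dotv u v = dotv v u.
Proof. by apply: eq_bigr => i _; rewrite mulrC. Qed.

Lemma dotvDl u v w : dotv (u + v) w = dotv u w + dotv v w.
Proof. by rewrite -big_split; apply: eq_bigr => i _; rewrite mxE mulrDl. Qed.

Lemma dotvZl (a : R) u v : dotv (a *: u) v = a * dotv u v.
Proof. by rewrite mulr_sumr; apply: eq_bigr => i _; rewrite mxE mulrA. Qed.

Lemma dotvNl u v : dotv (- u) v = - dotv u v.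
Proof. by rewrite -scaleN1r dotvZl mulN1r. Qed.

Lemma dotvDr u v w : dotv u (v + w) = dotv u v + dotv u w.
Proof. by rewrite dotvC dotvDl !(dotvC _ u). Qed.

Lemma dotvZr (a : R) u v : dotv u (a *: v) = a * dotv u v.
Proof. by rewrite dotvC dotvZl dotvC. Qed.

Lemma dotvNr u v : dotv u (- v) = - dotv u v.
Proof. by rewrite dotvC dotvNl dotvC. Qed.

Definition dotvE := (dotvDl, dotvDr, dotvNl, dotvNr, dotvZl, dotvZr).

Lemma dotv0 : dotv (0 : 'rV[R]_n) 0 = 0.
Proof. by rewrite -(scale0r 0) dotvZl mul0r. Qed.

Lemma dotv_ge0 u : 0 <= dotv u u.
Proof. by apply: sumr_ge0 => i _; rewrite -expr2 sqr_ge0. Qed.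

Lemma sqr_enorm u : enorm u ^+ 2 = dotv u u.
Proof. by rewrite sqr_sqrtr// dotv_ge0. Qed.

Lemma dotv_young (c : R) u v :
  0 < c -> 2 * dotv u v <= c * dotv u u + c^-1 * dotv v v.
Proof.
move=> c0; have := dotv_ge0 (c *: u - v); rewrite !dotvE (dotvC v u) => h.
rewrite -(ler_pM2l c0) mulrDr (mulrA c c^-1) mulfV ?gt_eqF// mul1r.
by nra.
Qed.

(** Convexity of the squared norm at [u] and [a^-1 *: v]; the two sides differ by
    $\frac{1-a}{a}\|au-v\|^2$. *)
Lemma dotv_convex (a : R) u v : 0 < a -> a <= 1 ->
  dotv ((1 - a) *: u + v) ((1 - a) *: u + v)
    <= (1 - a) * dotv u u + a^-1 * dotv v v.
Proof.
move=> a0 a1; have := dotv_ge0 (a *: u - v); rewrite !dotvE (dotvC v u) => h.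
rewrite -(ler_pM2l a0) [leRHS]mulrDr (mulrA a a^-1) mulfV ?gt_eqF// mul1r.
have : 0 <= (1 - a) * (a * (a * dotv u u) - a * dotv u v
    - (a * dotv u v - dotv v v)).
  by rewrite mulr_ge0 ?subr_ge0//; lra.
by lra.
Qed.

End EuclideanInnerProduct.

(** * Calculus along lines, the descent inequality and the first-order convexity inequality *)

Section GradientInequalities.
Variables (R : realType) (n : nat) (Psi : 'rV[R]_n -> R).
Hypothesis dPsi : forall x : 'rV[R]_n, differentiable Psi x.
Implicit Types x y d : 'rV[R]_n.

(** [grad] only collects partial derivatives; differentiability makes the derivative linear in [d],
    so [d] is expanded in the canonical basis. *)
Lemma derive_grad x d : 'D_d Psi x = dotv (grad Psi x) d.
Proof.
rewrite deriveE// {1}(row_sum_delta d) linear_sum.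
by apply: eq_bigr => i _; rewrite linearZ mxE deriveE// mulrC.
Qed.

Lemma is_derive_line x d (t : R) :
  is_derive t 1 (fun s : R => Psi (x + s *: d)) (dotv (grad Psi (x + t *: d)) d).
Proof.
have E : (fun h : R => h^-1 *: (Psi (x + (h *: 1 + t) *: d) - Psi (x + t *: d)))
  = (fun h : R => h^-1 *: (Psi (h *: d + (x + t *: d)) - Psi (x + t *: d))).
  apply/funext => h; congr (_ *: (Psi _ - _)).
  by rewrite [h *: 1]mulr1 scalerDl addrCA.
apply: DeriveDef; last first.
  by rewrite -derive_grad /derive /= E.
by rewrite /derivable /= E; exact: diff_derivable.
Qed.

Lemma continuous_line x d : continuous (fun s : R => Psi (x + s *: d)).
Proof.
move=> t; apply: differentiable_continuous; apply/derivable1_diffP.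
exact: (@ex_derive _ _ _ _ _ _ _ (is_derive_line x d t)).
Qed.

Lemma mean_value_grad x d : exists2 c : R,
  0 < c < 1 & Psi (x + d) - Psi x = dotv (grad Psi (x + c *: d)) d.
Proof.
have [c] := @MVT R (fun s => Psi (x + s *: d)) _ 0 1 ltr01
  (fun t _ => is_derive_line x d t)
  (continuous_subspaceT (continuous_line x d)).
rewrite in_itv/= scale1r scale0r addr0 subr0 mulr1.
by exists c.
Qed.

Variable L : R.
Hypothesis L_gt0 : 0 < L.
Hypothesis lipPsi : forall x y,
  enorm (grad Psi y - grad Psi x) <= L * enorm (y - x).

Lemma dotv_grad_lip x y :
  dotv (grad Psi y - grad Psi x) (grad Psi y - grad Psi x)
    <= L ^+ 2 * dotv (y - x) (y - x).
Proof.
rewrite -!sqr_enorm -exprMn ler_sqr// nnegrE ?mulr_ge0 ?sqrtr_ge0//.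
exact: ltW.
Qed.

Lemma dotv_grad_line x d (c : R) : 0 < c ->
  `|dotv (grad Psi (x + c *: d)) d - dotv (grad Psi x) d| <= L * c * dotv d d.
Proof.
move=> c0; have := dotv_grad_lip x (x + c *: d).
rewrite (addrC x) addrK !dotvZl !dotvZr => h.
have Lc : 0 < L * c by rewrite mulr_gt0.
set u := grad Psi (c *: d + x) - grad Psi x in h *.
have hu : (L * c)^-1 * dotv u u <= L * c * dotv d d.
  rewrite mulrC ler_pdivrMr//; apply: le_trans h _.
  by rewrite le_eqVlt; apply/orP; left; apply/eqP; ring.
(* Young with weight [(L * c)^-1], at [d] and at [- d], stands in for Cauchy-Schwarz: both terms on
   its right are at most [L * c * dotv d d]. *)
have := dotv_young _ _ (L * c)^-1 u d; have := dotv_young _ _ (L * c)^-1 u (- d).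
rewrite invr_gt0 invrK !dotvNr !dotvNl opprK => /(_ Lc) y1 /(_ Lc) y2.
by rewrite -dotvNl -dotvDl -/u ler_norml; lra.
Qed.

(** The mean value theorem replaces integration: subtracting the quadratic model along the segment
    leaves a function [f] with nonpositive derivative on $(0,1)$ by [dotv_grad_line], so
    [f 1 <= f 0]. *)
Lemma descent x d :
  Psi (x + d) <= Psi x + dotv (grad Psi x) d + L / 2 * dotv d d.
Proof.
pose g := dotv (grad Psi x) d; pose q := L / 2 * dotv d d.
pose f := fun s : R => Psi (x + s *: d) - (g * s + q * (s * s)).
have df (t : R) : is_derive t 1 f
    (dotv (grad Psi (x + t *: d)) d - (g + q * (t + t))).
  have := is_derive_line x d t => ?.
  by apply: is_derive_eq; rewrite /GRing.scale /=; ring.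
have cf : continuous f.
  move=> t; apply: differentiable_continuous; apply/derivable1_diffP.
  exact: (@ex_derive _ _ _ _ _ _ _ (df t)).
have [c] := @MVT R f _ 0 1 ltr01 (fun t _ => df t) (continuous_subspaceT cf).
rewrite in_itv/= /f scale1r scale0r addr0 => /andP[c0 _].
have := ler_normlW (dotv_grad_line x d c c0); rewrite /g /q; lra.
Qed.

(** The chord inequality at [x + t *: d] and the mean value theorem give a slope at an intermediate
    point, which is at least the slope at [x] minus [e] by the Lipschitz bound. Dividing by [t]
    concludes, as [e] is arbitrary. *)
Lemma convex_grad_le x y : convex_fun Psi ->
  Psi x + dotv (grad Psi x) (y - x) <= Psi y.
Proof.
move=> cPsi; set d := y - x; apply/ler_addgt0Pr => e e0.
(* t is so small that the second-order term L t^2 |d|^2 is at most t e. *)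
pose t := e / (L * dotv d d + e).
have Ld : 0 <= L * dotv d d by rewrite mulr_ge0 ?dotv_ge0// ltW.
have De : 0 < L * dotv d d + e by lra.
have t0 : 0 < t by rewrite divr_gt0.
have t1 : t <= 1 by rewrite ler_pdivrMr//; lra.
have te : t * (L * dotv d d) <= e.
  by rewrite /t mulrAC ler_pdivrMr//; nra.
have := cPsi y x t (ltW t0) t1.
have -> : t *: y + (1 - t) *: x = x + t *: d.
  by rewrite /d scalerBl scale1r scalerBr addrCA.
have [c /andP[c0 c1]] := mean_value_grad x (t *: d).
have := dotv_grad_line x d (c * t) (mulr_gt0 c0 t0).
rewrite ler_norml scalerA dotvZr => /andP[h1 _] h2 h3.
have : t * (Psi x + dotv (grad Psi x) d) <= t * (Psi y + e).
  have : t * (t * c * (L * dotv d d)) <= t * e.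
    by rewrite ler_pM2l//; nra.
  have := ler_wpM2l (ltW t0) h1; lra.
by rewrite ler_pM2l.
Qed.

End GradientInequalities.

(** * Finite sums: telescoping, exchange of order, weighted minimum *)

Section FiniteSums.
Variable R : realType.
Implicit Types (f w : nat -> R).

Lemma sum_1N_recr f (N : nat) :
  \sum_(1 <= k < N.+2) f k = \sum_(1 <= k < N.+1) f k + f N.+1.
Proof. by rewrite big_nat_recr. Qed.

Lemma ler_telescope (a b : nat -> R) (N : nat) :
  (forall k, (k < N)%N -> a k.+1 <= a k + b k.+1) ->
  a N <= a 0%N + \sum_(1 <= k < N.+1) b k.
Proof.
elim: N => [|N IH] h; first by rewrite big_geq// addr0.
rewrite big_nat_recr//= addrA; apply: le_trans (h N (ltnSn N)) _.
by rewrite lerD2r; apply: IH => k /ltnW; exact: h.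
Qed.

(** Both sides sum over the pairs $1\le t\le j\le N$. This turns partial sums of gap increments into
    the tail sums of [Gam] found in [Ck]. *)
Lemma sum_triangle_exchange f w (N : nat) :
  \sum_(1 <= j < N.+1) f j * (\sum_(1 <= t < j.+1) w t)
  = \sum_(1 <= t < N.+1) w t * (\sum_(t <= j < N.+1) f j).
Proof.
elim: N => [|N IH]; first by rewrite !big_geq.
rewrite [LHS]big_nat_recr//= [RHS]big_nat_recr//= IH big_nat1.
rewrite (big_nat_recr N.+1)//= mulrDr addrA (mulrC (w N.+1)); congr (_ + _).
rewrite mulr_sumr -big_split/=; apply: eq_big_nat => t /andP[_ tN].
by rewrite [in RHS]big_nat_recr/= ?mulrDr 1?(mulrC (f _))// ltnW.
Qed.

Lemma min_1N_mul_sum_le (N : nat) f w :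
  (forall k, (1 <= k <= N)%N -> 0 <= w k) ->
  min_1N N f * (\sum_(1 <= k < N.+1) w k) <= \sum_(1 <= k < N.+1) w k * f k.
Proof.
move=> w0; rewrite mulr_sumr; apply: ler_sum_nat => k kN.
rewrite mulrC ler_wpM2l// ?w0// /min_1N.
by apply: ge_bigmin_seq => //; rewrite mem_index_iota.
Qed.

Lemma sumr_1N_gt0 (N : nat) w : (1 <= N)%N ->
  (forall k, (1 <= k <= N)%N -> 0 < w k) -> 0 < \sum_(1 <= k < N.+1) w k.
Proof.
move=> N1 w0; rewrite big_nat_recr//=; apply: ltr_wpDl; last first.
  by apply: w0; rewrite N1 leqnn.
rewrite big_nat_cond; apply: sumr_ge0 => k /andP[/andP[k1 kN] _].
by apply/ltW/w0; rewrite k1 ltnW.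
Qed.

End FiniteSums.

(** One step of the convex case in bare reals: [D1], [D2] are value gaps, [r1], [r2] squared
    distances. Division by [G2] turns the coefficient [1 - a] of [D1] into [G1^-1], and the ratio
    hypothesis raises that of [r1] to the previous weight [c1]. *)
Lemma lyapunov_step (R : realType) (D1 D2 r1 r2 a l b gg G1 G2 c1 : R) :
  0 < l -> 0 < G1 -> 0 < G2 -> G2 = (1 - a) * G1 -> 0 <= r1 ->
  a / (l * G2) <= c1 ->
  D2 + b / 2 * gg <= (1 - a) * D1 + a / (2 * l) * (r1 - r2) ->
  D2 / G2 + a / (l * G2) * r2 / 2 + G2^-1 * b * gg / 2
    <= D1 / G1 + c1 * r1 / 2.
Proof.
move=> l0 G10 G20 eG r10 /(ler_wpM2r r10) hc h.
have {h} := ler_wpM2r (ltW (eqbRL (invr_gt0 G2) G20)) h.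
have a1 : 1 - a != 0.
  by apply/eqP => a1; move: G20; rewrite eG a1 mul0r ltxx.
have e1 : ((1 - a) * D1 + a / (2 * l) * (r1 - r2)) / G2
    = D1 / G1 + a / (l * G2) * r1 / 2 - a / (l * G2) * r2 / 2.
  by rewrite eG; field; rewrite a1/= !gt_eqF.
rewrite e1 => h; lra.
Qed.

(** * Iterates of the method and the bound without convexity *)

Section AcceleratedGradient.
Variables (R : realType) (n : nat) (Psi : 'rV[R]_n -> R) (L : R).
Variables (x0 : 'rV[R]_n) (alpha beta lambda : nat -> R).
Hypothesis dPsi : forall x : 'rV[R]_n, differentiable Psi x.
Hypothesis L_gt0 : 0 < L.
Hypothesis lipPsi : forall x y : 'rV[R]_n,
  enorm (grad Psi y - grad Psi x) <= L * enorm (y - x).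
Hypothesis alpha1 : alpha 1%N = 1.
Hypothesis alpha01 : forall k, (2 <= k)%N -> 0 < alpha k /\ alpha k < 1.
Hypothesis beta_gt0 : forall k, (1 <= k)%N -> 0 < beta k.
Hypothesis lambda_gt0 : forall k, (1 <= k)%N -> 0 < lambda k.

(** The iterates are arbitrary sequences satisfying the recurrences, so the estimates never unfold
    [ag_state]. *)
Variables x xag xmd : nat -> 'rV[R]_n.
Local Notation g := (fun k => grad Psi (xmd k)).
Local Notation G := (Gam alpha).
Hypothesis ag_x0 : x 0%N = x0.
Hypothesis ag_xag0 : xag 0%N = x0.
Hypothesis ag_xS : forall k, x k.+1 = x k - lambda k.+1 *: g k.+1.
Hypothesis ag_xagS : forall k, xag k.+1 = xmd k.+1 - beta k.+1 *: g k.+1.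
Hypothesis ag_xmdS : forall k,
  xmd k.+1 = (1 - alpha k.+1) *: xag k + alpha k.+1 *: x k.

Lemma alpha_bounds k : 0 < alpha k.+1 /\ alpha k.+1 <= 1.
Proof.
case: k => [|k]; first by rewrite alpha1 ltr01.
by have [a0 /ltW] := alpha01 k.+2 isT.
Qed.

Lemma GamSS k : G k.+2 = (1 - alpha k.+2) * G k.+1.
Proof. by []. Qed.

Lemma Gam_gt0 k : 0 < G k.
Proof.
case: k => [|k]; first exact: ltr01.
elim: k => [|k IH]; first exact: ltr01.
by rewrite GamSS mulr_gt0// subr_gt0; have [] := alpha01 k.+2.
Qed.

(** Both updates move along the same gradient, so only the difference of the step lengths enters. *)
Lemma ag_gapS k : xag k.+1 - x k.+1
  = (1 - alpha k.+1) *: (xag k - x k) + (lambda k.+1 - beta k.+1) *: g k.+1.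
Proof.
rewrite ag_xagS ag_xS ag_xmdS.
by apply/rowP => i; rewrite !mxE; ring.
Qed.

(** [E] is the squared gap rescaled by [Gam], which absorbs the contraction by [1 - alpha k]; [s k]
    bounds its increment at step [k]. *)
Let E k := dotv (xag k - x k) (xag k - x k) / G k.
Let s k := (lambda k - beta k) ^+ 2 / (alpha k * G k) * dotv (g k) (g k).

(* The recursion for Gam fails from 0 to 1; there both sides are 0. *)
Lemma ag_gap_Gam k :
  (1 - alpha k.+1) * dotv (xag k - x k) (xag k - x k) = G k.+1 * E k.
Proof.
case: k => [|k].
  by rewrite /E alpha1 ag_x0 ag_xag0 !subrr mul0r dotv0 mul0r mulr0.
by rewrite /E GamSS -mulrA; congr (_ * _); rewrite mulrC divfK// gt_eqF ?Gam_gt0.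
Qed.

Lemma ag_gap_le k : E k <= \sum_(1 <= t < k.+1) s t.
Proof.
have -> : \sum_(1 <= t < k.+1) s t = E 0%N + \sum_(1 <= t < k.+1) s t.
  by rewrite /E ag_x0 ag_xag0 subrr dotv0 mul0r add0r.
apply: ler_telescope => j _; rewrite {1}/E ag_gapS.
have [a0 a1] := alpha_bounds j; have G0 := Gam_gt0 j.+1.
rewrite ler_pdivrMr//; apply: le_trans (dotv_convex _ _ _ _ _ a0 a1) _.
rewrite ag_gap_Gam mulrDl mulrC lerD2l /s !dotvE.
rewrite le_eqVlt; apply/orP; left; apply/eqP; field.
by rewrite !gt_eqF.
Qed.

(** The gradient at [x k] is [g k.+1] minus an error. Young with weight [L^-1] splits the error's
    cross term: one half adds a second $\frac{L}{2}\lambda^2\|g\|^2$ to that of [descent], whence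
    [1 - L * lambda k.+1]; the other is controlled by the gap. *)
Lemma ag_step_x k : Psi (x k.+1) <= Psi (x k)
  - lambda k.+1 * (1 - L * lambda k.+1) * dotv (g k.+1) (g k.+1)
  + L / 2 * (G k.+1 * \sum_(1 <= t < k.+2) s t).
Proof.
set l := lambda k.+1; set a := alpha k.+1.
have [a0 a1] := alpha_bounds k.
have D := descent _ _ _ dPsi _ L_gt0 lipPsi (x k) (- (l *: g k.+1)).
have Y := dotv_young _ _ (L^-1) (grad Psi (xmd k.+1) - grad Psi (x k)) (l *: g k.+1).
have Li : 0 < L^-1 by rewrite invr_gt0.
have T : L^-1 * dotv (grad Psi (xmd k.+1) - grad Psi (x k))
   (grad Psi (xmd k.+1) - grad Psi (x k)) <= L * (G k.+1 * \sum_(1 <= t < k.+2) s t).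
  rewrite mulrC ler_pdivrMr//.
  apply: le_trans (dotv_grad_lip _ _ _ _ L_gt0 lipPsi _ _) _.
  have -> : xmd k.+1 - x k = (1 - a) *: (xag k - x k).
    rewrite ag_xmdS -/a; apply/rowP => i; rewrite !mxE.
    move: (xag k _ _) (x k _ _) => p q; ring.
  rewrite dotvZl dotvZr [leRHS]mulrC [leRHS]mulrA -expr2 ler_pM2l ?exprn_gt0//.
  (* $(1-a)^2\le 1-a$ leaves the single factor that [ag_gap_Gam] expects. *)
  apply: (@le_trans _ _ ((1 - a) * dotv (xag k - x k) (xag k - x k))).
    rewrite ler_piMl ?mulr_ge0 ?dotv_ge0//; rewrite ?subr_ge0//.
    by rewrite gerBl ltW.
  rewrite ag_gap_Gam ler_pM2l ?Gam_gt0//.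
  apply: le_trans (ag_gap_le k) _.
  (* Adding the nonnegative [s k.+1] aligns the sum with [G k.+1]; hence the tail sum in [Ck] starts
     at [k] itself. *)
  rewrite [leRHS]big_nat_recr//= lerDl /s mulr_ge0 ?dotv_ge0//.
  by rewrite divr_ge0 ?sqr_ge0// mulr_ge0 ?ltW ?Gam_gt0.
move: D Y T; rewrite -ag_xS invrK !dotvE => D /(_ Li) Y T.
set GS := G k.+1 * _ in T *.
by rewrite -/l; lra.
Qed.

Lemma ag_min_grad_le_nonconvex (N : nat) :
  has_lbound (range Psi) ->
  (1 <= N)%N ->
  (forall k, (1 <= k <= N)%N -> 0 < Ck L alpha beta lambda N k) ->
  min_1N N (fun k => enorm (g k) ^+ 2)
    <= (Psi x0 - inf (range Psi))
       / (\sum_(1 <= k < N.+1) lambda k * Ck L alpha beta lambda N k).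
Proof.
move=> lbPsi N1 C0.
have w0 k : (1 <= k <= N)%N -> 0 < lambda k * Ck L alpha beta lambda N k.
  by move=> kN; rewrite mulr_gt0 ?C0// lambda_gt0//; case/andP: kN.
rewrite ler_pdivlMr ?sumr_1N_gt0//.
apply: le_trans (min_1N_mul_sum_le _ _ _ _ _) _; first by move=> k /w0/ltW.
have := ler_telescope _ (fun k => Psi (x k)) (fun k =>
  - (lambda k * (1 - L * lambda k) * dotv (g k) (g k))
  + L / 2 * (G k * \sum_(1 <= t < k.+1) s t)) N.
move=> /(_ _)/wrap[k _|]; first by rewrite addrA; exact: ag_step_x.
(* After the exchange, $\|g_k\|^2$ has total coefficient $-\lambda_kC_k$. *)
rewrite big_split/= -mulr_sumr sum_triangle_exchange mulr_sumr -big_split/=.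
have : inf (range Psi) <= Psi (x N) by apply: ge_inf => //; exists (x N).
set S1 := \sum_(_ <= _ < _) _; set S2 := \sum_(_ <= _ < _) _ => h1 h2.
suff : S1 = - S2 by move: h1 h2; rewrite ag_x0; lra.
rewrite /S1 /S2 -sumrN; apply: eq_big_nat => k /andP[k1 _].
rewrite sqr_enorm /s /Ck; field.
by case: k k1 => // k _; rewrite !gt_eqF ?Gam_gt0 ?lambda_gt0//; case: (alpha_bounds k).
Qed.

(** * Bounds in the convex case *)

Section Convex.
Variable xstar : 'rV[R]_n.
Hypothesis cPsi : convex_fun Psi.
Hypothesis minPsi : forall y, Psi xstar <= Psi y.
Hypothesis stepsize : forall k, (1 <= k)%N ->
  alpha k * lambda k <= beta k /\ beta k < 1 / L.
Hypothesis ratio_nincr : forall k, (1 <= k)%N ->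
  alpha k.+1 / (lambda k.+1 * G k.+1) <= alpha k / (lambda k * G k).

Local Notation dist k := (dotv (x k - xstar) (x k - xstar)).
Local Notation w := (fun k => (G k)^-1 * beta k * (1 - L * beta k)).

Lemma ag_weight_gt0 k : (1 <= k)%N -> 0 < w k.
Proof.
move=> k1; have [_ ] := stepsize k k1.
rewrite ltr_pdivlMr// mulrC => Lb.
by rewrite !mulr_gt0 ?invr_gt0 ?Gam_gt0 ?beta_gt0// subr_gt0.
Qed.

(** The gradient inequalities towards [xag k] and [xstar], weighted by [1 - alpha k.+1] and
    [alpha k.+1], leave only the product of [g k.+1] with [x k - xstar], since [xmd k.+1] is the
    same average of [xag k] and [x k]. *)
Lemma ag_step_convex k :
  Psi (xag k.+1) - Psi xstar + beta k.+1 * (1 - L * beta k.+1) / 2 * dotv (g k.+1) (g k.+1)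
  <= (1 - alpha k.+1) * (Psi (xag k) - Psi xstar)
     + alpha k.+1 / (2 * lambda k.+1) * (dist k - dist k.+1).
Proof.
have [a0 a1] := alpha_bounds k; have l0 := lambda_gt0 k.+1 isT.
have [ab _] := stepsize k.+1 isT.
set a := alpha k.+1 in a0 a1 ab *; set l := lambda k.+1 in l0 ab *.
set b := beta k.+1 in ab *.
have D := descent _ _ _ dPsi _ L_gt0 lipPsi (xmd k.+1) (- (b *: g k.+1)).
have C1 := convex_grad_le _ _ _ dPsi _ L_gt0 lipPsi (xmd k.+1) (xag k) cPsi.
have C2 := convex_grad_le _ _ _ dPsi _ L_gt0 lipPsi (xmd k.+1) xstar cPsi.
have M : dotv (g k.+1) (xmd k.+1)
    = (1 - a) * dotv (g k.+1) (xag k) + a * dotv (g k.+1) (x k).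
  by rewrite -!dotvZr -dotvDr -ag_xmdS.
(* Expansion of $\|x_{k+1}-x^*\|^2$ along the update of [x]. *)
have -> : a / (2 * l) * (dist k - dist k.+1)
    = a * dotv (g k.+1) (x k - xstar) - a * l / 2 * dotv (g k.+1) (g k.+1).
  rewrite ag_xS -/l !dotvE !(dotvC _ _ _ (grad _ _)) (dotvC _ _ (x k) xstar).
  by field; rewrite gt_eqF.
move: D C1 C2; rewrite -ag_xagS !dotvE.
move: M; set gm := dotv _ (xmd k.+1); set gg := dotv (g k.+1) (g k.+1).
set ga := dotv _ (xag k); set gx := dotv _ (x k); set gs := dotv _ xstar.
move=> M; rewrite M => D C1 C2.
have gg0 : 0 <= gg by exact: dotv_ge0.
have a1' : 0 <= 1 - a by rewrite subr_ge0.
have := ler_wpM2l (ltW a0) C2; have := ler_wpM2l a1' C1.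
(* By [ab], the leftover $\frac{al}{2}\|g\|^2$ costs at most half of the decrease $b\|g\|^2$ from
   [descent]. *)
have := ler_wpM2r gg0 ab; move: D; lra.
Qed.

Lemma ag_lyapunov k :
  (Psi (xag k.+1) - Psi xstar) / G k.+1
  + alpha k.+1 / (lambda k.+1 * G k.+1) * dist k.+1 / 2
  + \sum_(1 <= j < k.+2) w j * dotv (g j) (g j) / 2
  <= dotv (x0 - xstar) (x0 - xstar) / (2 * lambda 1%N).
Proof.
elim: k => [|k IH].
  (* [alpha 1 = 1] cancels the initial value gap, so the bound involves only the initial
     distance. *)
  have := ag_step_convex 0; rewrite alpha1 big_nat1 /=.
  rewrite !divr1 invr1 !mul1r mulr1 subrr mul0r add0r ag_x0 => h.
  rewrite invfM.
  have l0 := lambda_gt0 1 isT.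
  move: h; rewrite invfM; nra.
apply: le_trans IH; rewrite (sum_1N_recr _ _ k.+1).
rewrite [X in _ + X <= _]addrC addrA lerD2r.
rewrite -[(G k.+2)^-1 * _ * _]mulrA.
apply: (lyapunov_step _ _ _ _ _ _ _ _ _ _ _ _ (lambda_gt0 k.+2 isT) (Gam_gt0 k.+1)
  (Gam_gt0 k.+2) (GamSS k) (dotv_ge0 _ _ _) (ratio_nincr k.+1 isT)
  (ag_step_convex k.+1)).
Qed.

(** The value and distance terms of [ag_lyapunov] are nonnegative and dropped; the halves on both
    sides cancel. *)
Lemma ag_min_grad_le_convex (N : nat) : (1 <= N)%N ->
  min_1N N (fun k => enorm (g k) ^+ 2)
    <= enorm (x0 - xstar) ^+ 2 / (lambda 1%N * \sum_(1 <= k < N.+1) w k).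
Proof.
case: N => // N _.
have l0 := lambda_gt0 1 isT.
have w0 k : (1 <= k <= N.+1)%N -> 0 < w k by case/andP => /ag_weight_gt0.
rewrite ler_pdivlMr; last by rewrite mulr_gt0 ?sumr_1N_gt0.
rewrite mulrCA mulrC -ler_pdivlMr//.
apply: le_trans (min_1N_mul_sum_le _ _ _ _ _) _; first by move=> k /w0/ltW.
have := ag_lyapunov N; rewrite -mulr_suml.
under eq_bigr do rewrite -sqr_enorm.
have : 0 <= (Psi (xag N.+1) - Psi xstar) / G N.+1.
  by rewrite divr_ge0 ?subr_ge0// ltW ?Gam_gt0.
have : 0 <= alpha N.+1 / (lambda N.+1 * G N.+1) * dist N.+1.
  rewrite mulr_ge0 ?dotv_ge0// divr_ge0 ?mulr_ge0 ?ltW ?Gam_gt0 ?lambda_gt0//.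
  by have [] := alpha_bounds N.
rewrite (invfM 2) (sqr_enorm _ _ (x0 - xstar)); lra.
Qed.

(** Here the distance term and the gradient sum of [ag_lyapunov] are dropped instead. *)
Lemma ag_value_gap_le (N : nat) : (1 <= N)%N ->
  Psi (xag N) - Psi xstar <= G N * enorm (x0 - xstar) ^+ 2 / (2 * lambda 1%N).
Proof.
case: N => // N _; rewrite -mulrA mulrC -ler_pdivrMr ?Gam_gt0// sqr_enorm.
apply: le_trans (ag_lyapunov N); rewrite -addrA lerDl addr_ge0//.
  rewrite divr_ge0// mulr_ge0 ?dotv_ge0//.
  rewrite divr_ge0 ?mulr_ge0 ?ltW ?Gam_gt0 ?lambda_gt0//.
  by have [] := alpha_bounds N.
rewrite big_nat_cond; apply: sumr_ge0 => k /andP[/andP[k1 _] _].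
by rewrite divr_ge0// mulr_ge0 ?dotv_ge0// ltW ?ag_weight_gt0.
Qed.

End Convex.
End AcceleratedGradient.

Theorem theorem1 (R : realType) (n : nat) (Psi : 'rV[R]_n -> R) (L : R)
  (x0 : 'rV[R]_n) (alpha beta lambda : nat -> R) :
  (forall x : 'rV[R]_n, differentiable Psi x) ->
  0 < L ->
  (forall x y : 'rV[R]_n,
     enorm (grad Psi y - grad Psi x) <= L * enorm (y - x)) ->
  (exists m : R, forall x, m <= Psi x) ->
  alpha 1%N = 1 ->
  (forall k, (2 <= k)%N -> 0 < alpha k /\ alpha k < 1) ->
  (forall k, (1 <= k)%N -> 0 < beta k) ->
  (forall k, (1 <= k)%N -> 0 < lambda k) ->
  let xmd := ag_xmd Psi x0 alpha beta lambda in
  let xag := ag_xag Psi x0 alpha beta lambda in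
  let Psistar := inf (range Psi) in
  (* part (a) *)
  (forall N : nat, (1 <= N)%N ->
     (forall k, (1 <= k <= N)%N -> 0 < Ck L alpha beta lambda N k) ->
     min_1N N (fun k => enorm (grad Psi (xmd k)) ^+ 2)
       <= (Psi x0 - Psistar)
          / (\sum_(1 <= k < N.+1) lambda k * Ck L alpha beta lambda N k))
  /\
  (* part (b) *)
  (convex_fun Psi ->
   forall xstar : 'rV[R]_n, (forall x, Psi xstar <= Psi x) ->
   (forall k, (1 <= k)%N -> alpha k * lambda k <= beta k /\ beta k < 1 / L) ->
   (forall k, (1 <= k)%N ->
      alpha k.+1 / (lambda k.+1 * Gam alpha k.+1)
        <= alpha k / (lambda k * Gam alpha k)) ->
   forall N : nat, (1 <= N)%N ->
     min_1N N (fun k => enorm (grad Psi (xmd k)) ^+ 2)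
       <= enorm (x0 - xstar) ^+ 2
          / (lambda 1%N * \sum_(1 <= k < N.+1)
               (Gam alpha k)^-1 * beta k * (1 - L * beta k))
     /\
     Psi (xag N) - Psi xstar
       <= Gam alpha N * enorm (x0 - xstar) ^+ 2 / (2 * lambda 1%N)).
Proof.
move=> dPsi L0 lipPsi [m mPsi] a1 a01 b0 l0 xmd xag Psistar.
(* The recurrences hold by computation: [xmd k.+1] unfolds to the point [md] inside [ag_state]. *)
have xS k : ag_x Psi x0 alpha beta lambda k.+1
    = ag_x Psi x0 alpha beta lambda k - lambda k.+1 *: grad Psi (xmd k.+1).
  by [].
have xagS k : xag k.+1 = xmd k.+1 - beta k.+1 *: grad Psi (xmd k.+1) by [].
have xmdS k : xmd k.+1 = (1 - alpha k.+1) *: xag k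
    + alpha k.+1 *: ag_x Psi x0 alpha beta lambda k by [].
split.
  move=> N N1 C0.
  have lbPsi : has_lbound (range Psi) by exists m => _ [y _ <-].
  exact: (ag_min_grad_le_nonconvex _ _ _ _ x0 _ _ _ dPsi L0 lipPsi a1 a01 l0
    _ xag xmd erefl erefl xS xagS xmdS).
move=> cPsi xs minPsi step ratio N N1; split.
  exact: (ag_min_grad_le_convex _ _ _ _ x0 _ _ _ dPsi L0 lipPsi a1 a01 b0 l0
    _ xag xmd erefl xS xagS xmdS).
exact: (ag_value_gap_le _ _ _ _ x0 _ _ _ dPsi L0 lipPsi a1 a01 b0 l0
  _ xag xmd erefl xS xagS xmdS).
Qed.
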